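(* Let $\mathbb{H}^2$ be the real hyperbolic plane, let $T_3$ be the infinite $3$-regular tree, and let $Z$ be a bounded degree graph with subexponential growth. Then there is no quasi-isometric embedding $\mathbb{H}^2\to T_3\times Z$.
   Context: Graphs carry their shortest path metric and $T_3\times Z$ a product metric (e.g. $\ell^1$). A bounded degree graph $Z$ has subexponential growth if $\lim_{r\to\infty}\frac1r\log|B(z,r)|=0$ for a (any) vertex $z$. *)

(* Defs.v *)
From Stdlib Require Import Reals Lra List.
From Coquelicot Require Import Coquelicot.
Import ListNotations.
Open Scope R_scope.

Inductive walk {V : Type} (adj : V -> V -> Prop) : nat -> V -> V -> Prop :=
| walk0 : forall x, walk adj 0 x x
| walkS : forall n x y z, adj x y -> walk adj n y z -> walk adj (S n) x z.

Definition is_gdist {V : Type} (adj : V -> V -> Prop) (x y : V) (n : nat) : Prop :=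
  walk adj n x y /\ forall m, walk adj m x y -> (n <= m)%nat.

Definition graph_symmetric {V : Type} (adj : V -> V -> Prop) : Prop :=
  forall x y, adj x y -> adj y x.

Definition graph_connected {V : Type} (adj : V -> V -> Prop) : Prop :=
  forall x y, exists n, walk adj n x y.

Definition bounded_degree {V : Type} (adj : V -> V -> Prop) : Prop :=
  exists D : nat, forall v (l : list V),
    NoDup l -> (forall w, In w l -> adj v w) -> (length l <= D)%nat.

Definition ball_card {V : Type} (adj : V -> V -> Prop) (z : V) (r N : nat) : Prop :=
  exists l : list V, NoDup l /\ length l = N /\
    forall w, In w l <-> exists m, (m <= r)%nat /\ walk adj m z w.

Definition subexponential_growth {V : Type} (adj : V -> V -> Prop) : Prop :=
  exists (z : V) (b : nat -> nat),
    (forall r, ball_card adj z r (b r)) /\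
    is_lim_seq (fun r => ln (INR (b r)) / INR r) (Finite 0).

(** * The infinite 3-regular tree T_3
    Vertices: reduced words over {0,1,2} with no two consecutive equal letters
    (Cayley graph of Z/2 * Z/2 * Z/2); edges: appending one letter. *)
Fixpoint reduced (w : list nat) : Prop :=
  match w with
  | [] => True
  | a :: w' => (a < 3)%nat /\
      match w' with [] => True | b :: _ => a <> b end /\ reduced w'
  end.

Definition T3 : Type := { w : list nat | reduced w }.

Definition T3adj (u v : T3) : Prop :=
  (exists a, proj1_sig v = proj1_sig u ++ [a]) \/
  (exists a, proj1_sig u = proj1_sig v ++ [a]).

Definition H2 : Type := { p : R * R | 0 < snd p }.

Definition arcosh (t : R) : R := ln (t + sqrt (t * t - 1)).

Definition dH (p q : H2) : R :=
  let x1 := fst (proj1_sig p) in let y1 := snd (proj1_sig p) in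
  let x2 := fst (proj1_sig q) in let y2 := snd (proj1_sig q) in
  arcosh (1 + ((x1 - x2) ^ 2 + (y1 - y2) ^ 2) / (2 * y1 * y2)).

Definition qi_embedding_H2_T3xZ {V : Type} (adj : V -> V -> Prop)
    (f : H2 -> T3 * V) : Prop :=
  exists L C : R, 1 <= L /\ 0 <= C /\
    forall (p q : H2) (n1 n2 : nat),
      is_gdist T3adj (fst (f p)) (fst (f q)) n1 ->
      is_gdist adj (snd (f p)) (snd (f q)) n2 ->
      dH p q / L - C <= INR (n1 + n2) <= L * dH p q + C.

(* Main.v *)
Require Import Defs.
From Stdlib Require Import Reals List.
From Coquelicot Require Import Coquelicot.
From Stdlib Require Import Lra Lia Classical ProofIrrelevance.
Import ListNotations.
Open Scope R_scope.

(** Let f = (phi, psi) be such an embedding, and look at the points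
    [(x, 2^-j)] of the upper half plane with [0 <= x <= 1] and [0 <= j <= n].
    Split the bottom row [j = n] into [2^m] arcs, where [n] is a large constant
    multiple of [m], and let [k] be a tree radius which phi cannot reach before
    depth [2 m], so that [k] is also linear in [m].
    If phi maps some arc outside the ball of radius [k] in the tree, then the
    whole arc lies behind one vertex at level [k], and every vertical ray ending
    on the arc crosses that vertex at depth at least [2 m]; rays at distance
    about [2^(-2m)] cross it at points which are far apart, so psi takes about
    [2^m] values.  Otherwise every arc contains a point which phi maps into the
    ball of radius [k]; since [n] is much larger than [k], these points are
    separated by psi, which again takes [2^m] values.  As psi stays in a ball of
    radius linear in [m], both cases contradict subexponential growth. *)

(** * Walks and graph distance *)

Lemma walk_app {V : Type} (adj : V -> V -> Prop) (m n : nat) (x y z : V) :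
  walk adj m x y -> walk adj n y z -> walk adj (m + n) x z.
Proof.
  intros H; revert z; induction H as [x | m x y y' Hxy H IH]; intros z Hz.
  - exact Hz.
  - simpl. apply walkS with y; auto.
Qed.

Lemma walk_sym {V : Type} (adj : V -> V -> Prop) (n : nat) (x y : V) :
  graph_symmetric adj -> walk adj n x y -> walk adj n y x.
Proof.
  intros Hs H; induction H as [x | n x y z Hxy H IH].
  - constructor.
  - replace (S n) with (n + 1)%nat by lia.
    apply walk_app with y; [exact IH |].
    apply walkS with x; [now apply Hs | constructor].
Qed.

(** Least number principle. It is needed because a quasi-isometric embedding only constrains numbers
    already known to satisfy [is_gdist]. *)
Lemma gdist_le_walk {V : Type} (adj : V -> V -> Prop) (n : nat) (x y : V) :
  walk adj n x y -> exists d, is_gdist adj x y d /\ (d <= n)%nat.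
Proof.
  induction n as [n IH] using (well_founded_induction Wf_nat.lt_wf); intros Hn.
  destruct (classic (exists m, walk adj m x y /\ (m < n)%nat)) as [[m [Hm Hlt]] | Hmin].
  - destruct (IH m Hlt Hm) as [d [Hd Hdm]]. exists d; split; [exact Hd | lia].
  - exists n; repeat split; auto.
    intros m Hm. destruct (Nat.le_gt_cases n m); auto.
    exfalso; apply Hmin; eauto.
Qed.

(** * The tree *)

Definition word (u : T3) : list nat := proj1_sig u.

Lemma word_inj (u v : T3) : word u = word v -> u = v.
Proof.
  destruct u as [u Hu], v as [v Hv]; simpl; intros ->.
  f_equal; apply proof_irrelevance.
Qed.

Lemma reduced_app_l (u s : list nat) : reduced (u ++ s) -> reduced u.
Proof.
  induction u as [| a u IH]; simpl; [auto |].
  intros [Ha [Hb Hr]]; repeat split; auto.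
  destruct u; simpl in *; auto.
Qed.

Lemma T3adj_sym : graph_symmetric T3adj.
Proof. intros u v [H | H]; [right | left]; exact H. Qed.

Lemma T3_walk_to_prefix (s : list nat) (u v : T3) :
  word v = word u ++ s -> walk T3adj (length s) v u.
Proof.
  revert v; induction s as [| a s IH] using rev_ind; intros v Hv.
  - rewrite app_nil_r in Hv. apply word_inj in Hv; subst; constructor.
  - rewrite app_assoc in Hv.
    assert (Hr : reduced (word u ++ s)).
    { apply reduced_app_l with [a]. rewrite <- Hv. exact (proj2_sig v). }
    rewrite length_app, Nat.add_comm.
    apply walkS with (exist _ _ Hr).
    + right; exists a; exact Hv.
    + now apply IH.
Qed.

(** Delete letters down to the shared prefix, then append. With [k = 0] the walk passes through the
    root, so the tree is connected. *)
Lemma T3_walk_common_prefix (k : nat) (u v : T3) :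
  firstn k (word u) = firstn k (word v) ->
  walk T3adj ((length (word u) - k) + (length (word v) - k)) u v.
Proof.
  intros H.
  assert (Hr : reduced (firstn k (word u))).
  { apply reduced_app_l with (skipn k (word u)).
    rewrite firstn_skipn. exact (proj2_sig u). }
  set (w := exist _ _ Hr : T3).
  assert (Hd : forall t : T3, firstn k (word t) = word w ->
    walk T3adj (length (word t) - k) t w).
  { intros t Ht. rewrite <- length_skipn.
    apply T3_walk_to_prefix. rewrite <- Ht. symmetry; apply firstn_skipn. }
  apply walk_app with w; [now apply Hd |].
  apply walk_sym; [exact T3adj_sym | now apply Hd].
Qed.

Lemma T3_walk_length (n : nat) (u v : T3) :
  walk T3adj n u v -> (length (word v) <= length (word u) + n)%nat.
Proof.
  intros H; induction H as [u | n u v w Huv H IH]; [lia |].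
  destruct Huv as [[a Ha] | [a Ha]]; fold (word u) (word v) in Ha;
    apply (f_equal (@length nat)) in Ha; rewrite length_app in Ha; simpl in Ha; lia.
Qed.

(** The walk is too short to leave depth at least [k], so it only changes letters beyond position
    [k]. *)
Lemma T3_walk_same_prefix (k n : nat) (u v : T3) :
  walk T3adj n u v -> (k + n <= length (word u))%nat ->
  firstn k (word u) = firstn k (word v).
Proof.
  intros H; induction H as [u | n u v w Huv H IH]; intros Hk; [reflexivity |].
  destruct Huv as [[a Ha] | [a Ha]]; fold (word u) (word v) in Ha;
    pose proof (f_equal (@length nat) Ha) as Hl; rewrite length_app in Hl; simpl in Hl.
  - rewrite <- IH by lia. rewrite Ha, firstn_app.
    replace (k - length (word u))%nat with 0%nat by lia.
    now rewrite app_nil_r.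
  - rewrite <- IH by lia. rewrite Ha, firstn_app.
    replace (k - length (word v))%nat with 0%nat by lia.
    now rewrite app_nil_r.
Qed.

(** The margin [D] keeps the walks that fill the jumps at depth at least [k], so the path stays
    behind one vertex of level [k]. *)
Lemma T3_path_same_prefix (u : nat -> T3) (k D n : nat) :
  (forall t, exists a, (a <= D)%nat /\ walk T3adj a (u t) (u (S t))) ->
  (forall t, (t <= n)%nat -> (k + D <= length (word (u t)))%nat) ->
  forall t, (t <= n)%nat -> firstn k (word (u t)) = firstn k (word (u 0%nat)).
Proof.
  intros Hstep Hfar t; induction t as [| t IH]; intros Ht; [reflexivity |].
  rewrite <- IH by lia.
  destruct (Hstep t) as [a [Ha Hw]]. symmetry.
  apply T3_walk_same_prefix with a; [exact Hw |].
  specialize (Hfar t). lia.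
Qed.

(** Go back from the endpoint: while the depth exceeds [k + D], the predecessor has depth at least
    [k] and the same prefix. As the path starts at depth less than [k], this stops inside the
    window. *)
Lemma T3_path_crossing (u : nat -> T3) (k D n : nat) :
  (forall j, exists a, (a <= D)%nat /\ walk T3adj a (u j) (u (S j))) ->
  (length (word (u 0%nat)) < k)%nat -> (k <= length (word (u n)))%nat ->
  exists j, (j <= n)%nat /\ (k <= length (word (u j)) <= k + D)%nat /\
    firstn k (word (u j)) = firstn k (word (u n)).
Proof.
  intros Hstep H0; induction n as [| n IH]; intros Hn; [lia |].
  destruct (Nat.le_gt_cases (length (word (u (S n)))) (k + D)) as [Hle | Hgt].
  - exists (S n); auto.
  - destruct (Hstep n) as [a [Ha Hw]].
    pose proof (T3_walk_length _ _ _ Hw) as Hl.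
    apply (walk_sym _ _ _ _ T3adj_sym) in Hw.
    apply (T3_walk_same_prefix k) in Hw; [| lia].
    rewrite Hw. destruct IH as [j [Hj Hc]]; [lia |].
    exists j; split; [lia | exact Hc].
Qed.

(** * The half plane *)

Lemma half_pow_pos (j : nat) : 0 < (/ 2) ^ j.
Proof. apply pow_lt; lra. Qed.

(** The index [j] acts as a depth: one step down has hyperbolic length ln 2, and the horizontal
    scale at depth [j] is [2^-j]. *)
Definition pt (x : R) (j : nat) : H2 := exist _ (x, (/ 2) ^ j) (half_pow_pos j).

Lemma ln_le_sub_1 (t : R) : 0 < t -> ln t <= t - 1.
Proof.
  intros Ht. pose proof (exp_ineq1_le (ln t)) as H. rewrite exp_ln in H; lra.
Qed.

Lemma ln_pow_2 (n : nat) : INR n / 2 <= ln (2 ^ n) <= INR n.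
Proof.
  rewrite ln_pow by lra.
  pose proof ln_lt_2. pose proof (ln_le_sub_1 2). pose proof (pos_INR n).
  split; nra.
Qed.

Lemma arcosh_le (t : R) : 1 <= t -> arcosh t <= ln (2 * t).
Proof.
  intros Ht. unfold arcosh.
  assert (sqrt (t * t - 1) <= t).
  { apply Rle_trans with (sqrt (t * t)); [apply sqrt_le_1_alt; lra |].
    rewrite sqrt_square; lra. }
  pose proof (sqrt_pos (t * t - 1)).
  apply ln_le; lra.
Qed.

Lemma arcosh_ge (t : R) : 1 <= t -> ln t <= arcosh t.
Proof.
  intros Ht. unfold arcosh. pose proof (sqrt_pos (t * t - 1)).
  apply ln_le; lra.
Qed.

Lemma dH_step_horizontal (x x' : R) (j : nat) :
  Rabs (x - x') <= (/ 2) ^ j -> dH (pt x j) (pt x' j) <= 2.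
Proof.
  intros H. unfold dH; simpl fst; simpl snd. set (y := (/ 2) ^ j) in *.
  assert (Hy : 0 < y) by apply half_pow_pos.
  assert (Hyy : 0 < 2 * y * y) by nra.
  assert (Hsq : (x - x') ^ 2 <= y ^ 2).
  { rewrite <- (pow2_abs (x - x')). apply pow_incr; split; [apply Rabs_pos | exact H]. }
  set (t := _ / _).
  assert (Ht : 0 <= t <= / 2).
  { unfold t. pose proof (pow2_ge_0 (x - x')). split.
    - apply Rdiv_le_0_compat; nra.
    - apply (proj2 (Rle_div_l _ _ _ Hyy)). nra. }
  eapply Rle_trans; [apply arcosh_le; lra |].
  eapply Rle_trans; [apply ln_le_sub_1; lra | lra].
Qed.

Lemma dH_step_vertical (x : R) (j : nat) : dH (pt x j) (pt x (S j)) <= 2.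
Proof.
  unfold dH; simpl. set (y := (/ 2) ^ j).
  assert (Hy : 0 < y) by apply half_pow_pos.
  replace (_ / _) with (/ 4) by (field; lra).
  eapply Rle_trans; [apply arcosh_le; lra |].
  eapply Rle_trans; [apply ln_le_sub_1; lra | lra].
Qed.

Lemma dH_from_base (x : R) (j : nat) :
  0 <= x <= 1 -> dH (pt 0 0) (pt x j) <= INR (j + 2).
Proof.
  intros Hx. unfold dH; simpl fst; simpl snd.
  assert (Hy : 0 < (/ 2) ^ j <= 1).
  { split; [apply half_pow_pos | rewrite <- (pow1 j); apply pow_incr; lra]. }
  assert (Hi : / ((/ 2) ^ j) = 2 ^ j) by (rewrite <- pow_inv, Rinv_inv; reflexivity).
  assert (H2 : 1 <= 2 ^ j) by (apply pow_R1_Rle; lra).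
  set (y := (/ 2) ^ j) in *. rewrite <- Hi in H2.
  set (t := _ / _).
  assert (Ht : 0 <= t <= / y).
  { unfold t. replace ((/ 2) ^ 0) with 1 by (simpl; ring).
    assert (H2y : 0 < 2 * 1 * y) by lra. split.
    - apply Rdiv_le_0_compat; nra.
    - apply (proj2 (Rle_div_l _ _ _ H2y)).
      replace (/ y * (2 * 1 * y)) with 2 by (field; lra). nra. }
  eapply Rle_trans; [apply arcosh_le; lra |].
  (* The summand 2 comes from [2 * (1 + 2^j) <= 4 * 2^j]. *)
  apply Rle_trans with (ln (2 ^ (j + 2))); [| apply ln_pow_2].
  apply ln_le; [lra |]. rewrite pow_add, <- Hi. simpl. lra.
Qed.

(** A geodesic between the points must climb to height about [2^-a]. In the formula, the product of
    the heights is at most [4^-(a+m)], so the argument of [arcosh] is at least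
    [1 + 4^m / 2 >= 2^m]. *)
Lemma dH_lower (x x' : R) (a m i j : nat) :
  (/ 2) ^ a <= Rabs (x - x') -> (a + m <= i)%nat -> (a + m <= j)%nat ->
  INR m / 2 <= dH (pt x i) (pt x' j).
Proof.
  intros H Hi Hj. unfold dH; simpl.
  assert (Hle : forall l, (a + m <= l)%nat -> (/ 2) ^ l <= (/ 2) ^ a * (/ 2) ^ m).
  { intros l Hl. replace l with ((a + m) + (l - (a + m)))%nat by lia.
    rewrite !pow_add.
    pose proof (half_pow_pos a). pose proof (half_pow_pos m).
    assert ((/ 2) ^ (l - (a + m)) <= 1).
    { rewrite <- (pow1 (l - (a + m))). apply pow_incr; lra. }
    assert (0 < (/ 2) ^ a * (/ 2) ^ m) by nra. nra. }
  apply Hle in Hi. apply Hle in Hj.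
  assert (Hsq : ((/ 2) ^ a) ^ 2 <= (x - x') ^ 2).
  { rewrite <- (pow2_abs (x - x')). apply pow_incr; split; [| exact H].
    left; apply half_pow_pos. }
  pose proof (half_pow_pos i) as Pi. pose proof (half_pow_pos j) as Pj.
  pose proof (half_pow_pos a) as Pa. pose proof (half_pow_pos m) as Pm.
  assert (Hm : (/ 2) ^ m * 2 ^ m = 1) by (rewrite <- Rpow_mult_distr, Rinv_l, pow1; lra).
  assert (P2 : 1 <= 2 ^ m) by (apply pow_R1_Rle; lra).
  set (yi := (/ 2) ^ i) in *. set (yj := (/ 2) ^ j) in *.
  set (ya := (/ 2) ^ a) in *. set (ym := (/ 2) ^ m) in *. set (M := 2 ^ m) in *.
  assert (Hp : 0 < yi * yj <= (ya * ym) * (ya * ym)) by (split; [nra | apply Rmult_le_compat; lra]).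
  assert (Ht : M <= 1 + ((x - x') ^ 2 + (yi - yj) ^ 2) / (2 * yi * yj)).
  { apply Rle_trans with (1 + M * M / 2); [nra |].
    apply Rplus_le_compat_l. assert (Hyy : 0 < 2 * yi * yj) by lra.
    apply (proj1 (Rle_div_r _ _ _ Hyy)).
    apply Rle_trans with (M * M * ((ya * ym) * (ya * ym))); [nra |].
    replace (M * M * ((ya * ym) * (ya * ym))) with (ya ^ 2 * (ym * M) ^ 2) by ring.
    rewrite Hm. pose proof (pow2_ge_0 (yi - yj)). lra. }
  apply Rle_trans with (ln M); [apply ln_pow_2 |].
  eapply Rle_trans; [apply ln_le; [lra | exact Ht] |].
  apply arcosh_ge. lra.
Qed.

Lemma Rabs_INR_sub_ge_1 (i j : nat) : i <> j -> 1 <= Rabs (INR i - INR j).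
Proof.
  intros H. destruct (Nat.lt_gt_cases i j) as [[Hlt | Hlt] _]; [exact H | |].
  - apply le_INR in Hlt. rewrite S_INR in Hlt. rewrite Rabs_left1; lra.
  - apply le_INR in Hlt. rewrite S_INR in Hlt. rewrite Rabs_right; lra.
Qed.

Lemma INR_pow2_half (m : nat) : INR (2 ^ m) * (/ 2) ^ m = 1.
Proof. rewrite pow_INR. simpl INR. rewrite <- Rpow_mult_distr, Rinv_r, pow1; lra. Qed.

(** * Counting *)

(** Choose witnesses one index at a time; disjointness makes each new one differ from all earlier
    ones. *)
Lemma length_ge_of_disjoint_witnesses {V : Type} (N : nat) (P : nat -> V -> Prop) (l : list V) :
  (forall i, (i < N)%nat -> exists v, P i v /\ In v l) ->
  (forall i j v, P i v -> P j v -> i = j) ->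
  (N <= length l)%nat.
Proof.
  intros Hex Hinj.
  assert (H : forall n, (n <= N)%nat -> exists l', NoDup l' /\ length l' = n /\ incl l' l /\
    forall v, In v l' -> exists i, (i < n)%nat /\ P i v).
  { induction n as [| n IH]; intros Hn.
    - exists []; repeat split; [constructor | intros v [] | intros v []].
    - destruct IH as [l' [Hnd [Hlen [Hincl Hl']]]]; [lia |].
      destruct (Hex n Hn) as [v [Hv Hvl]].
      exists (v :: l'); repeat split.
      + constructor; [| exact Hnd]. intros Hin.
        destruct (Hl' v Hin) as [i [Hi Hiv]]. pose proof (Hinj _ _ _ Hv Hiv). lia.
      + simpl; now rewrite Hlen.
      + intros w [<- | Hw]; auto.
      + intros w [<- | Hw]; [exists n; split; [lia | exact Hv] |].
        destruct (Hl' w Hw) as [i [Hi Hiw]]. exists i; split; [lia | exact Hiw]. }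
  destruct (H N (le_n N)) as [l' [Hnd [Hlen [Hincl _]]]].
  rewrite <- Hlen. now apply NoDup_incl_length.
Qed.

(** For [m >= 1] the radius is at most [(A + B) * m], so the quotient would be at least
    [1 / (2 * (A + B))] along a sequence of radii tending to infinity. *)
Lemma subexponential_not_exponential (b : nat -> nat) (A B : nat) :
  (1 <= A)%nat -> is_lim_seq (fun r => ln (INR (b r)) / INR r) (Finite 0) ->
  ~ forall m, (2 ^ m <= b (A * m + B))%nat.
Proof.
  intros HA Hlim Hexp.
  assert (HAB : 0 < INR (A + B)) by (apply lt_0_INR; lia).
  assert (He : 0 < / (2 * INR (A + B))) by (apply Rinv_0_lt_compat; lra).
  apply is_lim_seq_spec in Hlim. destruct (Hlim (mkposreal _ He)) as [N HN].
  (* This [m] is positive and, as [A >= 1], gives a radius of at least [N]. *)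
  simpl in HN. set (m := S N). specialize (HN (A * m + B)%nat ltac:(nia)).
  specialize (Hexp m). apply le_INR in Hexp. rewrite pow_INR in Hexp. simpl INR in Hexp.
  assert (Hln : INR m / 2 <= ln (INR (b (A * m + B)%nat))).
  { apply Rle_trans with (ln (2 ^ m)); [apply ln_pow_2 |].
    apply ln_le; [apply pow_lt; lra | exact Hexp]. }
  assert (HR : 0 < INR (A * m + B) <= INR (A + B) * INR m).
  { split; [apply lt_0_INR; nia | rewrite <- mult_INR; apply le_INR; nia]. }
  rewrite Rminus_0_r in HN. apply (Rle_lt_trans _ _ _ (Rle_abs _)) in HN.
  apply (proj1 (Rlt_div_l _ _ _ (proj1 HR))) in HN.
  assert (/ (2 * INR (A + B)) * INR (A * m + B) <= INR m / 2).
  { replace (INR m / 2) with (/ (2 * INR (A + B)) * (INR (A + B) * INR m)) by (field; lra).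
    apply Rmult_le_compat_l; lra. }
  lra.
Qed.

(** * Quasi-isometric embeddings *)

(** The upper inequality, with natural constants and with walks in place of distances, so that no
    minimality is carried along. *)
Definition coarse_lipschitz {V : Type} (adj : V -> V -> Prop) (f : H2 -> T3 * V)
    (L C : nat) : Prop :=
  forall p q d, dH p q <= INR d -> exists a b, (a + b <= L * d + C)%nat /\
    walk T3adj a (fst (f p)) (fst (f q)) /\ walk adj b (snd (f p)) (snd (f q)).

(** The lower inequality where the second coordinates agree: there the tree factor alone accounts
    for the distance. *)
Definition coarse_expanding_on_fibres {V : Type} (f : H2 -> T3 * V) (L C : nat) : Prop :=
  forall p q a, walk T3adj a (fst (f p)) (fst (f q)) -> snd (f p) = snd (f q) ->
    dH p q <= INR (L * (a + C)).

Lemma qi_embedding_coarse {V : Type} (adj : V -> V -> Prop) (f : H2 -> T3 * V) :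
  graph_connected adj -> qi_embedding_H2_T3xZ adj f ->
  exists L C, coarse_lipschitz adj f L C /\ coarse_expanding_on_fibres f L C.
Proof.
  intros Hconn [L [C [HL [HC H]]]].
  destruct (INR_unbounded L) as [L' HL']. destruct (INR_unbounded C) as [C' HC'].
  exists L', C'; split.
  - intros p q d Hd.
    destruct (gdist_le_walk _ _ _ _ (T3_walk_common_prefix 0 (fst (f p)) (fst (f q)) eq_refl))
      as [a [Ha _]].
    destruct (Hconn (snd (f p)) (snd (f q))) as [b' Hb'].
    destruct (gdist_le_walk _ _ _ _ Hb') as [b [Hb _]].
    exists a, b; split; [| split; [apply Ha | apply Hb]].
    destruct (H p q a b Ha Hb) as [_ Hab].
    apply INR_le. rewrite (plus_INR (L' * d)), mult_INR.
    pose proof (pos_INR d).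
    apply Rle_trans with (L * dH p q + C); [exact Hab |]. nra.
  - intros p q a Ha Heq.
    destruct (gdist_le_walk _ _ _ _ Ha) as [a' [Ha' Hle]].
    assert (Hb : is_gdist adj (snd (f p)) (snd (f q)) 0).
    { rewrite Heq; split; [constructor | intros; lia]. }
    destruct (H p q a' 0%nat Ha' Hb) as [Hlow _].
    rewrite Nat.add_0_r in Hlow. apply le_INR in Hle. pose proof (pos_INR a).
    rewrite mult_INR, plus_INR.
    assert (Hd : dH p q / L <= INR a + C) by lra.
    assert (HL0 : 0 < L) by lra.
    apply (proj1 (Rle_div_l _ _ _ HL0)) in Hd. nra.
Qed.

(** * Exponentially many values of psi in a ball of linear radius *)

Lemma embedding_forces_exponential_growth {V : Type} (adj : V -> V -> Prop)
    (f : H2 -> T3 * V) (z : V) (L C : nat) :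
  graph_connected adj -> coarse_lipschitz adj f L C -> coarse_expanding_on_fibres f L C ->
  exists A B : nat, (1 <= A)%nat /\ forall (m : nat) (l : list V),
    (forall w, (exists i, (i <= A * m + B)%nat /\ walk adj i z w) -> In w l) ->
    (2 ^ m <= length l)%nat.
Proof.
  intros Hconn Hlip Hexp.
  set (phi p := fst (f p)). set (psi p := snd (f p)). set (o := pt 0 0).
  destruct (Hconn z (psi o)) as [cz Hcz].
  set (c := length (word (phi o))).
  (* Bounds the tree jump between neighbouring points, which are at distance at most 2. *)
  set (D := (L * 2 + C)%nat).
  set (alpha := (2 * (L * (2 * D + C)) + 1)%nat).
  (* Constant terms of the linear functions below: [k = c' + 2 * L * m] and
     [n = (2 + 8 * L * L) * m + B]. *)
  set (c' := (c + L * (alpha + 3) + C + 1)%nat).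
  set (B := (2 * (L * (2 * (c' + D) + C)) + 2)%nat).
  (* From the bound [cz + L * (n + 2) + C] on the distance from [z]; the leading 1 ensures
     [1 <= A]. *)
  exists (1 + L * (2 + 8 * L * L))%nat, (cz + L * (B + 2) + C)%nat.
  split; [lia |]. intros m l Hl.
  (* [alpha] is chosen so that rays [2^-(2m+1)] apart are, from depth [s] on, too
     far apart for psi to agree on two of their points within [2 D] in the tree. *)
  set (s := (2 * m + 1 + alpha)%nat).
  (* Exceeds every tree depth that phi can reach before depth [s]. *)
  set (k := (c + L * (s + 2) + C + 1)%nat).
  (* [M / 2] exceeds the bound from [Hexp] for two points mapped within [k + D] of the root. The
     summand [m] gives [m <= M], so that [M - m] below is a true difference. *)
  set (M := (2 * (L * (2 * (k + D) + C)) + m + 1)%nat).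
  set (n := (S m + M)%nat).
  assert (Hdepth : forall x j, 0 <= x <= 1 ->
    (length (word (phi (pt x j))) <= c + L * (j + 2) + C)%nat).
  { intros x j Hx. destruct (Hlip o (pt x j) (j + 2)%nat) as [a [b [Hab [Ha _]]]].
    - now apply dH_from_base.
    - apply T3_walk_length in Ha.
      change (length (word (phi (pt x j))) <= c + a)%nat in Ha. lia. }
  assert (Hball : forall x j, 0 <= x <= 1 -> (j <= n)%nat -> In (psi (pt x j)) l).
  { intros x j Hx Hj. destruct (Hlip o (pt x j) (j + 2)%nat) as [a [b [Hab [_ Hb]]]].
    - now apply dH_from_base.
    - apply Hl. exists (cz + b)%nat; split; [| now apply walk_app with (psi o)].
      assert (L * (j + 2) <= L * (n + 2))%nat by (apply Nat.mul_le_mono_l; lia).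
      assert ((1 + L * (2 + 8 * L * L)) * m + (cz + L * (B + 2) + C) =
        cz + L * (n + 2) + C + m)%nat by (unfold n, M, k, s, B, c'; ring).
      lia. }
  (* Point [t] of arc [i], for [t <= 2^M]. The arc fills only the left half of its interval of
     length [2^-m], leaving gaps of length [2^-(m+1)]. *)
  set (x i t := INR i * (/ 2) ^ m + INR t * (/ 2) ^ n).
  assert (Hfrac : forall t, (t <= 2 ^ M)%nat -> 0 <= INR t * (/ 2) ^ n <= (/ 2) ^ S m).
  { intros t Ht. pose proof (half_pow_pos (S m)). pose proof (half_pow_pos M).
    apply le_INR in Ht. pose proof (pos_INR t). pose proof (INR_pow2_half M).
    unfold n. rewrite pow_add.
    assert (0 <= INR t * (/ 2) ^ M <= 1) by nra. nra. }
  assert (Hx : forall i t, (i < 2 ^ m)%nat -> (t <= 2 ^ M)%nat -> 0 <= x i t <= 1).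
  { intros i t Hi Ht. pose proof (Hfrac t Ht) as Hf. rewrite <- tech_pow_Rmult in Hf.
    apply le_INR in Hi. rewrite S_INR in Hi. pose proof (pos_INR i).
    pose proof (INR_pow2_half m). pose proof (half_pow_pos m).
    assert (0 <= INR i * (/ 2) ^ m) by (apply Rmult_le_pos; lra).
    assert ((INR i + 1) * (/ 2) ^ m <= INR (2 ^ m) * (/ 2) ^ m)
      by (apply Rmult_le_compat_r; lra).
    unfold x. lra. }
  assert (Hcol : forall y j, exists a, (a <= D)%nat /\
    walk T3adj a (phi (pt y j)) (phi (pt y (S j)))).
  { intros y j. destruct (Hlip (pt y j) (pt y (S j)) 2%nat) as [a [b [Hab [Ha _]]]].
    - apply dH_step_vertical.
    - exists a; split; [unfold D; lia | exact Ha]. }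
  destruct (classic (exists i, (i < 2 ^ m)%nat /\ forall t, (t <= 2 ^ M)%nat ->
    (k + D <= length (word (phi (pt (x i t) n))))%nat)) as [[i [Hi Hfar]] | Hnear].
  - assert (Hrow : forall t, exists a, (a <= D)%nat /\
      walk T3adj a (phi (pt (x i t) n)) (phi (pt (x i (S t)) n))).
    { intros t. destruct (Hlip (pt (x i t) n) (pt (x i (S t)) n) 2%nat)
        as [a [b [Hab [Ha _]]]].
      - apply dH_step_horizontal. unfold x. rewrite S_INR.
        pose proof (half_pow_pos n). rewrite Rabs_left1; lra.
      - exists a; split; [unfold D; lia | exact Ha]. }
    pose proof (T3_path_same_prefix (fun t => phi (pt (x i t) n)) k D _ Hrow Hfar) as Hsame.
    simpl in Hsame.
    (* Selects rays of the arc at spacing [2^(M-m) * 2^-n = 2^-(2m+1)]. *)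
    set (ray r := x i (r * 2 ^ (M - m))%nat).
    apply (length_ge_of_disjoint_witnesses (2 ^ m)
      (fun r v => (r < 2 ^ m)%nat /\ exists j, (s <= j)%nat /\ psi (pt (ray r) j) = v /\
        (k <= length (word (phi (pt (ray r) j))) <= k + D)%nat /\
        firstn k (word (phi (pt (ray r) j))) = firstn k (word (phi (pt (x i 0%nat) n))))).
    + intros r Hr.
      assert (Ht : (r * 2 ^ (M - m) <= 2 ^ M)%nat).
      { replace M with (m + (M - m))%nat at 2 by (unfold M; lia).
        rewrite Nat.pow_add_r. apply Nat.mul_le_mono_r. lia. }
      destruct (T3_path_crossing (fun j => phi (pt (ray r) j)) k D n)
        as [j [Hj [Hlen Hpre]]].
      * apply Hcol.
      * pose proof (Hdepth (ray r) 0%nat (Hx _ _ Hi Ht)).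
        assert (L * (0 + 2) <= L * (s + 2))%nat by (apply Nat.mul_le_mono_l; lia).
        unfold k. lia.
      * pose proof (Hfar _ Ht). unfold ray; lia.
      * exists (psi (pt (ray r) j)). split; [| apply Hball; [now apply Hx | exact Hj]].
        split; [exact Hr |]. exists j; repeat split; try lia.
        (* By the choice of [k], the crossing cannot occur before depth [s]. *)
        -- pose proof (Hdepth (ray r) j (Hx _ _ Hi Ht)).
           destruct (Nat.le_gt_cases s j); [assumption |].
           assert (L * (j + 2) <= L * (s + 2))%nat by (apply Nat.mul_le_mono_l; lia).
           unfold k in Hlen. lia.
        -- rewrite Hpre. now apply Hsame.
    + intros r r' v [Hr [j [Hj [Hv [Hlen Hpre]]]]] [Hr' [j' [Hj' [Hv' [Hlen' Hpre']]]]].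
      destruct (Nat.eq_dec r r') as [E | Hne]; [exact E | exfalso].
      (* Both crossings lie within [D] of the same vertex of level [k], hence within [2 * D] of each
         other; equal values of psi then contradict the choice of [alpha]. *)
      assert (Hw := T3_walk_common_prefix k _ _ (eq_trans Hpre (eq_sym Hpre'))).
      apply (Hexp (pt (ray r) j) (pt (ray r') j')) in Hw; [| exact (eq_trans Hv (eq_sym Hv'))].
      assert (Hsep : (/ 2) ^ (2 * m + 1) <= Rabs (ray r - ray r')).
      { assert (Hray : forall r0, ray r0 = INR i * (/ 2) ^ m + INR r0 * (/ 2) ^ (2 * m + 1)).
        { intros r0. unfold ray, x. f_equal. rewrite mult_INR.
          replace n with ((M - m) + (2 * m + 1))%nat by (unfold n, M; lia).
          rewrite pow_add. pose proof (INR_pow2_half (M - m)) as E.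
          transitivity (INR r0 * (INR (2 ^ (M - m)) * (/ 2) ^ (M - m)) * (/ 2) ^ (2 * m + 1));
            [ring | rewrite E; ring]. }
        rewrite !Hray.
        replace (_ - _) with ((INR r - INR r') * (/ 2) ^ (2 * m + 1)) by ring.
        rewrite Rabs_mult, (Rabs_right ((/ 2) ^ _)) by (left; apply half_pow_pos).
        pose proof (Rabs_INR_sub_ge_1 _ _ Hne). pose proof (half_pow_pos (2 * m + 1)). nra. }
      pose proof (dH_lower _ _ _ alpha j j' Hsep Hj Hj') as Hlow.
      assert (Hup : dH (pt (ray r) j) (pt (ray r') j') <= INR (L * (2 * D + C))).
      { eapply Rle_trans; [exact Hw | apply le_INR, Nat.mul_le_mono_l; lia]. }
      unfold alpha in Hlow. rewrite plus_INR, (mult_INR 2) in Hlow.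
      change (INR 2) with 2 in Hlow. change (INR 1) with 1 in Hlow. lra.
  - apply (length_ge_of_disjoint_witnesses (2 ^ m)
      (fun i v => exists t, (t <= 2 ^ M)%nat /\ psi (pt (x i t) n) = v /\
        (length (word (phi (pt (x i t) n))) <= k + D)%nat)).
    + intros i Hi.
      destruct (classic (exists t, (t <= 2 ^ M)%nat /\
        (length (word (phi (pt (x i t) n))) <= k + D)%nat)) as [[t [Ht Hlen]] | Hno].
      * exists (psi (pt (x i t) n)); split; [eauto | apply Hball; [now apply Hx | lia]].
      * exfalso. apply Hnear. exists i; split; [exact Hi |]. intros t Ht.
        destruct (Nat.le_gt_cases (length (word (phi (pt (x i t) n)))) (k + D)); [| lia].
        exfalso; eauto.
    + intros i i' v [t [Ht [Hv Hlen]]] [t' [Ht' [Hv' Hlen']]].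
      destruct (Nat.eq_dec i i') as [E | Hne]; [exact E | exfalso].
      (* Through the root, the two images are at most [2 * (k + D)] apart in the tree; [M] was
         chosen to exclude this. *)
      assert (Hw := T3_walk_common_prefix 0 (phi (pt (x i t) n)) (phi (pt (x i' t') n)) eq_refl).
      apply (Hexp (pt (x i t) n) (pt (x i' t') n)) in Hw; [| exact (eq_trans Hv (eq_sym Hv'))].
      (* Left ends of distinct arcs differ by at least [2^-m], and the offsets in the arcs change
         this by at most [2^-(m+1)]. *)
      assert (Hsep : (/ 2) ^ S m <= Rabs (x i t - x i' t')).
      { pose proof (Hfrac t Ht) as F. pose proof (Hfrac t' Ht') as F'.
        pose proof (Rabs_INR_sub_ge_1 _ _ Hne) as Hd. pose proof (half_pow_pos m).
        assert (Hm : (/ 2) ^ m <= Rabs ((INR i - INR i') * (/ 2) ^ m)).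
        { rewrite Rabs_mult, (Rabs_right ((/ 2) ^ m)) by lra. nra. }
        unfold x. rewrite <- tech_pow_Rmult in F, F' |- *. revert Hm. unfold Rabs.
        repeat destruct Rcase_abs; intros; lra. }
      pose proof (dH_lower _ _ _ M n n Hsep (le_n _) (le_n _)) as Hlow.
      assert (Hup : dH (pt (x i t) n) (pt (x i' t') n) <= INR (L * (2 * (k + D) + C))).
      { eapply Rle_trans; [exact Hw | apply le_INR, Nat.mul_le_mono_l; lia]. }
      unfold M in Hlow. rewrite plus_INR, (plus_INR _ m), (mult_INR 2) in Hlow.
      change (INR 2) with 2 in Hlow. change (INR 1) with 1 in Hlow.
      pose proof (pos_INR m). lra.
Qed.

Theorem theoremB (V : Type) (adj : V -> V -> Prop)
  (Hsym : graph_symmetric adj) (Hconn : graph_connected adj)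
  (Hdeg : bounded_degree adj) (Hgrowth : subexponential_growth adj) :
  ~ exists f : H2 -> T3 * V, qi_embedding_H2_T3xZ adj f.
Proof.
  intros [f Hf].
  destruct (qi_embedding_coarse adj f Hconn Hf) as [L [C [Hlip Hexp]]].
  destruct Hgrowth as [z [b [Hb Hlim]]].
  destruct (embedding_forces_exponential_growth adj f z L C Hconn Hlip Hexp)
    as [A [B [HA H]]].
  apply (subexponential_not_exponential b A B HA Hlim).
  (* The list enumerating the ball has length [b (A * m + B)] and contains all the vertices
     required. *)
  intros m. destruct (Hb (A * m + B)%nat) as [l [_ [<- Hl]]].
  apply H. intros w Hw. now apply Hl.
Qed.
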